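(* Let $D$ be a finite st-DAG with source $s$ and target $t \neq s$, let $D'$ be a finite st-DAG with source $s'$ and target $t' \neq s'$, and let $P$ be the st-DAG (with source $s$ and target $t'$) obtained from the disjoint union of $D$ and $D'$ by identifying the vertex $t$ with the vertex $s'$. Then for all integers $k \ge 0$ and all real $L$, $$MH_{k,L}^{(s,t')}(P) = 0.$$
   Context: A DAG is a directed acyclic graph; all digraphs are finite. An st-DAG (also called a two-terminal DAG) is a DAG with a unique source (vertex of indegree zero) and a unique target (vertex of outdegree zero). On the vertex set $V(D)$ of a digraph $D$, let $d(u,v) \in [0,\infty]$ be the length (number of arcs) of a shortest directed path from $u$ to $v$, with $d(u,u)=0$ and $d(u,v)=\infty$ if there is no directed path from $u$ to $v$. Fix a commutative coefficient ring $R$. A $k$-simplex is an ordered tuple $x=(x_0,\dots,x_k) \in V(D)^{k+1}$ whose adjacent entries are distinct; its length is $\lambda(x) = \sum_{j=1}^k d(x_{j-1},x_j)$. For real $L$, let $MC_{k,L}(D)$ be the free $R$-module on the $k$-simplices $x$ with $\lambda(x)=L$. The differential $\partial_k : MC_{k,L}(D) \to MC_{k-1,L}(D)$ is $\partial_k = \sum_{j=1}^{k-1} (-1)^j \partial^{(j)}$, where $\partial^{(j)}(x)$ is the tuple obtained from $x$ by deleting the entry $x_j$ if $d(x_{j-1},x_{j+1}) = d(x_{j-1},x_j) + d(x_j,x_{j+1})$, and $\partial^{(j)}(x)=0$ otherwise. For vertices $a,b$, $MC_{\bullet,L}^{(a,b)}(D)$ is the subcomplex of $MC_{\bullet,L}(D)$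 generated by simplices with $x_0=a$ and $x_k=b$, and $MH_{k,L}^{(a,b)}(D)$ denotes its $k$-th homology (magnitude homology). *)

(* Defs.v *)
(* MathComp, with MathComp-Analysis for the (extended) real numbers. *)
From HB Require Import structures.
From mathcomp Require Import all_boot all_order all_algebra.
From mathcomp Require Import boolp reals constructive_ereal.

Set Implicit Arguments.
Unset Strict Implicit.
Unset Printing Implicit Defensive.

Import Order.TTheory GRing.Theory Num.Theory.

Local Open Scope ring_scope.
Local Open Scope quotient_scope.

Record digraph := Digraph { vertex :> finType; arc : rel vertex }.

Section Digraphs.
Variable D : digraph.

Definition acyclic : Prop := forall c : seq D, cycle (@arc D) c -> c = [::].

Definition indegree (v : D) : nat := #|[set u | arc u v]|.
Definition outdegree (v : D) : nat := #|[set w | arc v w]|.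

Definition st_dag (s t : D) : Prop :=
  [/\ acyclic,
      forall v : D, indegree v = 0%N <-> v = s
    & forall v : D, outdegree v = 0%N <-> v = t].

Definition walk (n : nat) (u v : D) : bool :=
  [exists p : n.-tuple D, path (@arc D) u p && (last u p == v)].

(* A walk of minimal length repeats no vertex, so minimizing over walks amounts
   to minimizing over paths; the walk of length 0 gives d(u, u) = 0. *)
Definition dist (K : realType) (u v : D) : \bar K :=
  if pselect (exists n, walk n u v) is left h then (ex_minn h)%:R%:E else +oo%E.

(* The entry x_j of a tuple x = (x_0, ..., x_k); only used for j <= k. *)
Definition entry (k : nat) (x : k.+1.-tuple D) (j : nat) : D :=
  nth (thead x) x j.

Definition len (K : realType) (k : nat) (x : k.+1.-tuple D) : \bar K :=
  (\sum_(1 <= j < k.+1) dist K (entry x j.-1) (entry x j))%E.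

Definition is_simplex (K : realType) (k : nat) (L : K) : pred (k.+1.-tuple D) :=
  fun x => sorted (fun u v => u != v) x && (len K x == L%:E).

Definition simplex (K : realType) (k : nat) (L : K) : finType :=
  {x : k.+1.-tuple D | is_simplex L x}.

Definition del (k : nat) (x : k.+1.-tuple D) (j : nat) : seq D :=
  take j x ++ drop j.+1 x.

End Digraphs.

Section QuotientModule.
Variables (R : pzRingType) (V : lmodType R) (B : {pred V}).
Hypothesis submodB : submod_closed B.

Let S : {pred V} := B.
HB.instance Definition _ := GRing.isSubmodClosed.Build R V S submodB.

Definition quot_mod : Type := Quotient.quot S.
HB.instance Definition _ := GRing.Zmodule.on quot_mod.
HB.instance Definition _ : EqQuotient V (Quotient.equiv S) quot_mod :=
  EqQuotient.on quot_mod.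
HB.instance Definition _ := ZmodQuotient.on quot_mod.

Definition quot_scale (r : R) := lift_op1 quot_mod ( *:%R r).

Lemma pi_scale r : {morph \pi : v / r *: v >-> quot_scale r v}.
Proof.
move=> v; unlock quot_scale; apply/eqP; rewrite -Quotient.idealrBE -scalerBr.
by apply: rpredZ; rewrite Quotient.idealrBE reprK.
Qed.
Canonical pi_scale_morph r := PiMorph1 (pi_scale r).

Lemma quot_scaleA r r' v :
  quot_scale r (quot_scale r' v) = quot_scale (r * r') v.
Proof. by elim/quotW: v => v; rewrite !piE scalerA. Qed.

Lemma quot_scale1 : left_id 1 quot_scale.
Proof. by elim/quotW=> v; rewrite !piE scale1r. Qed.

Lemma quot_scaleDr : right_distributive quot_scale +%R.
Proof.
by move=> r; elim/quotW=> v; elim/quotW=> w; rewrite !piE scalerDr.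
Qed.

Lemma quot_scaleDl v : {morph quot_scale^~ v : r r' / r + r'}.
Proof. by elim/quotW: v => v r r'; rewrite !piE scalerDl. Qed.

HB.instance Definition _ := GRing.Zmodule_isLmodule.Build R quot_mod
  quot_scaleA quot_scale1 quot_scaleDr quot_scaleDl.

End QuotientModule.

Section MagnitudeHomology.
Variables (R : comPzRingType) (D : digraph) (K : realType).
Implicit Types (k : nat) (L : K).

Definition MC k L : lmodType R := {ffun simplex D k L -> R^o}.

(* The image of the basis element x under the j-th face map, for 0 < j < k. It
   is a chain in degree k.-1, in which y is the basis element whose underlying
   sequence is x with x_j deleted (see faceE). *)
Definition face k L (j : nat) (x : simplex D k L) : MC k.-1 L :=
  let d i i' := dist K (entry (val x) i) (entry (val x) i') in
  if d j.-1 j.+1 == (d j.-1 j + d j j.+1)%E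
  then [ffun y : simplex D k.-1 L => (tval (val y) == del (val x) j)%:R]
  else 0.

Lemma dist_refl (u : D) : dist K u u = 0%:E.
Proof.
rewrite /dist; case: pselect => [h|[]]; last first.
  by exists 0%N; apply/existsP; exists [tuple]; rewrite /= eqxx.
case: ex_minnP => n _ /(_ 0%N)/(_ _)/wrap[|]; last by rewrite leqn0 => /eqP->.
by apply/existsP; exists [tuple]; rewrite /= eqxx.
Qed.

Lemma dist_ge0 (u v : D) : (0 <= dist K u v)%E.
Proof.
rewrite /dist; case: pselect => [h|_]; first by rewrite lee_fin ler0n.
exact: leey.
Qed.

Lemma dist_eq0 (u v : D) : dist K u v = 0%:E -> u = v.
Proof.
rewrite /dist; case: pselect => // h; case: ex_minnP => n w _ [/eqP].
rewrite pnatr_eq0 => /eqP n0; move: w; rewrite n0.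
by case/existsP => p; rewrite tuple0 /= => /eqP.
Qed.

Lemma del_simplex k L j (x : simplex D k L) (y : k.-1.+1.-tuple D) :
  (0 < j < k)%N ->
  (dist K (entry (val x) j.-1) (entry (val x) j.+1) =
     dist K (entry (val x) j.-1) (entry (val x) j) +
     dist K (entry (val x) j) (entry (val x) j.+1))%E ->
  tval y = del (val x) j -> is_simplex L y.
Proof.
case: j => [//|j] /= jk dE yE; case: x dE yE => x /= /andP[sx /eqP lx] dE yE.
have szx : size x = k.+1 by rewrite size_tuple.
have [n kE] : exists n, k = (j + n).+2.
  by exists (k - j.+2)%N; rewrite -addSn -addSn subnKC.
subst k; move: y yE => /= y yE.
have ye i : (i < (j + n).+2)%N ->
    entry y i = entry x (if (i < j.+1)%N then i else i.+1).
  move=> ik; have yi : (i < size y)%N by rewrite size_tuple.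
  rewrite /entry (set_nth_default (thead x)) // yE /del nth_cat size_takel.
    case: ltnP => ij; first by rewrite nth_take.
    by rewrite nth_drop addSn subnKC.
  by rewrite szx ltnW // ltnS ltnW.
have xne i : (i < (j + n).+2)%N -> entry x i != entry x i.+1.
  by move=> ik; apply: (sortedP (thead x) sx); rewrite szx ltnS.
apply/andP; split.
  apply/(sortedP (thead y)) => i; rewrite size_tuple ltnS => ik.
  change (entry y i != entry y i.+1).
  rewrite !ye; [|by []|exact: ltnW].
  have [ij|ij] := ltnP i.+1 j.+1.
    by rewrite (ltnW ij); apply: xne; apply: ltnW.
  have [ij'|ij'] := ltnP i j.+1; last exact: xne.
  have -> : i = j by apply/eqP; rewrite eqn_leq -ltnS ij' -ltnS.
  apply/eqP => xe; move: dE; rewrite -xe dist_refl => /esym/eqP.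
  rewrite padde_eq0 ?dist_ge0 // => /andP[/eqP/dist_eq0 e _].
  have jk' : (j < (j + n).+2)%N by rewrite ltnS (leq_trans (leq_addr n j)).
  by have := xne j jk'; rewrite e eqxx.
rewrite -lx /len !big_add1 /=.
have jn : (j <= (j + n).+1)%N by rewrite ltnW // ltnS leq_addr.
have jn' : (j < (j + n).+1)%N by rewrite ltnS leq_addr.
rewrite (big_cat_nat (leq0n j) jn) (big_cat_nat (leq0n j) (leqW jn)) /=.
apply/eqP; congr (_ + _)%E.
  apply: eq_big_nat => i /andP[_ ij].
  have ij1 : (i < (j + n).+1)%N := ltn_trans ij jn'.
  rewrite !ye; try solve [exact: ij1 | exact: ltnW].
  have ij2 : (i < j.+1)%N := ltnW ij.
  have ij3 : (i.+1 < j.+1)%N := ij.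
  by rewrite ij2 ij3.
rewrite big_ltn // [RHS]big_ltn; last exact: ltnW.
rewrite [in RHS]big_ltn // addeA; congr (_ + _)%E.
  rewrite !ye; try solve [exact: jn' | exact: ltnW].
  by rewrite ltnSn ltnn; exact: dE.
rewrite [in RHS]big_add1 /=; apply: eq_big_nat => i /andP[ij ik].
rewrite !ye; try solve [exact: ik | exact: ltnW].
have -> : (i < j.+1)%N = false by rewrite ltnNge ij.
by have -> : (i.+1 < j.+1)%N = false by rewrite ltnNge (leqW ij).
Qed.

Lemma faceE k L j (x : simplex D k L) :
  (0 < j < k)%N ->
  (dist K (entry (val x) j.-1) (entry (val x) j.+1) =
     dist K (entry (val x) j.-1) (entry (val x) j) +
     dist K (entry (val x) j) (entry (val x) j.+1))%E ->
  exists2 y : simplex D k.-1 L, tval (val y) = del (val x) j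
    & face j x = [ffun z => (z == y)%:R].
Proof.
move=> jk dE.
have sz : size (del (val x) j) == k.-1.+1.
  case/andP: jk => j0 jk; rewrite size_cat size_drop size_takel size_tuple.
    by rewrite subSS prednK ?(leq_trans _ jk) // subnKC // ltnW.
  by rewrite ltnW // ltnS ltnW.
exists (Sub (Tuple sz) (del_simplex (y := Tuple sz) jk dE erefl)) => //.
rewrite /face dE eqxx; apply/ffunP => z; rewrite !ffunE.
by congr (nat_of_bool _)%:R; rewrite -[RHS]val_eqE -val_eqE.
Qed.

(* In degree 0 the sum over j is empty, so that diff 0 is the zero map, as the
   map MC 0 -> MC (-1) = 0 has to be. *)
Definition diff k L (c : MC k L) : MC k.-1 L :=
  \sum_(x : simplex D k L)
    c x *: \sum_(1 <= j < k) (-1) ^+ j *: face j x.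

Variables a b : D.

(* The span of the basis elements x with x_0 = a and x_k = b, as a submodule
   of MC k L. *)
Definition MCab k L : {pred MC k L} :=
  fun c => [forall x : simplex D k L, (c x != 0) ==>
             (entry (val x) 0 == a) && (entry (val x) k == b)].

Definition is_cycle k L : {pred MC k L} :=
  fun c => (c \in @MCab k L) && (diff c == 0).

Lemma diff_linear k L : linear (@diff k L).
Proof.
move=> r c c'; rewrite /diff scaler_sumr -big_split /=; apply: eq_bigr => x _.
by rewrite !ffunE scalerDl scalerA.
Qed.

HB.instance Definition _ k L := GRing.isLinear.Build R (MC k L) (MC k.-1 L) _
  (@diff k L) (@diff_linear k L).

Lemma MCab_submod k L : submod_closed (@MCab k L).
Proof.
split=> [|r c c' /forallP hc /forallP hc'].
  by apply/forallP => x; rewrite ffunE eqxx.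
apply/forallP => x; apply/implyP; rewrite !ffunE => nz.
have [c0|/(implyP (hc x))//] := eqVneq (c x) 0.
by apply: (implyP (hc' x)); move: nz; rewrite c0 scaler0 add0r.
Qed.

Lemma is_cycle_submod k L : submod_closed (@is_cycle k L).
Proof.
have [h0 hD] := MCab_submod k L.
split=> [|r c c' /andP[hc /eqP ec] /andP[hc' /eqP ec']]; apply/andP; split=> //.
- by rewrite raddf0.
- exact: hD.
- by rewrite diff_linear ec ec' scaler0 addr0.
Qed.

HB.instance Definition _ k L := GRing.isSubmodClosed.Build R (MC k L)
  (@is_cycle k L) (@is_cycle_submod k L).

Record cycles k L := Cycle { cycle_val : MC k L; _ : is_cycle cycle_val }.
HB.instance Definition _ k L := [isSub for @cycle_val k L].
HB.instance Definition _ k L := [Choice of cycles k L by <:].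
HB.instance Definition _ k L :=
  [SubChoice_isSubLmodule of cycles k L by <:].

(* The image of the degree k.+1 part of the (a, b)-subcomplex. *)
Definition boundaries k L : {pred cycles k L} :=
  fun z => `[< exists2 c : MC k.+1 L, c \in @MCab k.+1 L & diff c = val z >].

Lemma boundaries_submod k L : submod_closed (@boundaries k L).
Proof.
have [h0 hD] := MCab_submod k.+1 L.
split=> [|r z z' /asboolP[c hc ec] /asboolP[c' hc' ec']]; apply/asboolP.
  by exists 0; [exact: h0 | rewrite raddf0].
by exists (r *: c + c'); [exact: hD | rewrite diff_linear ec ec'].
Qed.

Definition MH k L : lmodType R := quot_mod (@boundaries_submod k L).

End MagnitudeHomology.

Section Gluing.
Variables (D D' : digraph) (t : D) (s' : D').

Definition disjoint_union : digraph :=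
  @Digraph (D + D')%type (fun x y =>
    match x, y with
    | inl u, inl v => arc u v
    | inr u, inr v => arc u v
    | _, _ => false
    end).

Definition glue_rel : rel (D + D')%type := fun x y =>
  [|| x == y, (x == inl t) && (y == inr s') | (x == inr s') && (y == inl t)].

Lemma glue_rel_refl : reflexive glue_rel.
Proof. by move=> x; rewrite /glue_rel eqxx. Qed.

Lemma glue_rel_sym : symmetric glue_rel.
Proof.
move=> x y; rewrite /glue_rel eq_sym [_ && (y == _)]andbC [_ && (y == _)]andbC.
by rewrite [X in _ || X]orbC.
Qed.

Lemma glue_rel_trans : transitive glue_rel.
Proof.
by move=> y x z /or3P[/eqP->//|/andP[/eqP-> /eqP->]|/andP[/eqP-> /eqP->]]
  /or3P[/eqP<-|/andP[/eqP e /eqP->]|/andP[/eqP e /eqP->]];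
  rewrite /glue_rel ?eqxx ?orbT.
Qed.

Canonical glue_equiv :=
  EquivRel glue_rel glue_rel_refl glue_rel_sym glue_rel_trans.

Definition glue_vertex : Type := {eq_quot glue_rel}.
HB.instance Definition _ := EqQuotient.on glue_vertex.
HB.instance Definition _ := Choice.on glue_vertex.
HB.instance Definition _ : isCountable glue_vertex :=
  CanIsCountable (@reprK _ glue_vertex).
HB.instance Definition _ : isFinite glue_vertex :=
  CanIsFinite (@reprK _ glue_vertex).

(* Arcs are the images of the arcs of the disjoint union. *)
Definition glue_arc : rel glue_vertex := fun x y =>
  [exists u : disjoint_union, exists v : disjoint_union,
    [&& arc u v, \pi_glue_vertex u == x & \pi_glue_vertex v == y]].

Definition glue : digraph := @Digraph glue_vertex glue_arc.

Definition glue_inl (u : D) : glue := \pi_glue_vertex (inl u).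
Definition glue_inr (u : D') : glue := \pi_glue_vertex (inr u).

End Gluing.

(* Main.v *)
From HB Require Import structures.
From mathcomp Require Import all_boot all_order all_algebra.
From mathcomp Require Import boolp reals constructive_ereal.
Require Import Defs.

Set Implicit Arguments.
Unset Strict Implicit.
Unset Printing Implicit Defensive.

Import Order.TTheory GRing.Theory Num.Theory.

Local Open Scope ring_scope.

(** The identified vertex m = t = s' is a cut vertex of P: no arc enters the set
A of the vertices of D other than t, since t has no outgoing arc, and every arc
leaving A ends at m. So every walk from a vertex u of A to a vertex v outside A
visits m, whence d(u, v) = d(u, m) + d(m, v) ([dist_through_separator]), while
d(v, u) is infinite ([dist_notin_in]).

A simplex from s to t' has finite length, so that it is a concatenation u ++ v
of nonempty sequences, with the entries of u in A and those of v outside A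
([finite_path_crossing]). By additivity, u ++ m :: v has the same length as
u ++ v; it is a simplex unless v starts with m. The map

       h (u ++ v) = (-1) ^ |u| (u ++ m :: v),

where the right-hand side is read as 0 if v starts with m, is a contracting
homotopy: d h + h d = 1 ([homotopy_formula]). The faces of u ++ m :: v, other
than the one deleting the new m, are up to sign the insertions of m into the
faces of u ++ v. If v starts with m, then h (u ++ v) = 0, and h kills all the
faces of u ++ v except the one that deletes this m, which it sends back to
u ++ v up to a sign that the differential compensates. Hence a cycle z is the
boundary of h z. The argument takes place in an arbitrary digraph with such a
set A ([MH_separator_eq0]).

The case distinctions in the definition of the differential are avoided by
letting [basis k L q] be the basis element of the sequence q if q is a
k-simplex of length L, and 0 for any other sequence. As L is fixed, the
condition under which a face is nonzero only says that the shortened sequence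
still has length L, so that every face is [basis] of the shortened sequence
([face_basis]). *)

(** * Distances across a separating vertex *)

Section Distance.
Variables (G : digraph) (K : realType).
Implicit Types (u v w : G) (n : nat) (p : seq G).

Lemma walkP n u v :
  reflect (exists p, [/\ size p = n, path (@arc G) u p & last u p = v])
          (walk n u v).
Proof.
apply: (iffP existsP) => [[p /andP[up /eqP pv]]|[p [/eqP pn up /eqP pv]]].
  by exists p; rewrite size_tuple.
by exists (Tuple pn); rewrite up.
Qed.

Lemma walk_cat n n' u v w : walk n u v -> walk n' v w -> walk (n + n') u w.
Proof.
move=> /walkP[p [<- up pv]] /walkP[p' [<- vp' p'w]]; apply/walkP.
by exists (p ++ p'); rewrite size_cat cat_path last_cat pv up.
Qed.

Lemma dist_le n u v : walk n u v -> (dist K u v <= n%:R%:E)%E.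
Proof.
move=> nuv; rewrite /dist; case: pselect => [h|[]]; last by exists n.
by case: ex_minnP => i _ /(_ _ nuv); rewrite lee_fin ler_nat.
Qed.

Variant dist_spec u v : \bar K -> Prop :=
| DistWalk n of walk n u v : dist_spec u v n%:R%:E
| DistNoWalk of (forall n, ~~ walk n u v) : dist_spec u v +oo%E.

Lemma distP u v : dist_spec u v (dist K u v).
Proof.
rewrite /dist; case: pselect => [h|noh].
  by case: ex_minnP => i iuv _; left.
by right=> n; apply/negP => nuv; apply: noh; exists n.
Qed.

Lemma dist_triangle v u w : (dist K u w <= dist K u v + dist K v w)%E.
Proof.
case: (distP u v) => [n nuv|_]; case: (distP v w) => [n' nvw|_];
  rewrite ?addye ?addey ?leey //.
by rewrite -EFinD -natrD; apply/dist_le/(walk_cat nuv nvw).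
Qed.

Section Separator.
Variables (A : pred G) (m : G).
Hypothesis noin : forall u v, arc u v -> v \in A -> u \in A.
Hypothesis outm : forall u v, arc u v -> u \in A -> v \notin A -> v = m.

Lemma dist_notin_in u v : u \notin A -> v \in A -> dist K u v = +oo%E.
Proof.
move=> uA vA; case: distP => // n /walkP[p [_ up pv]].
suff : last u p \notin A by rewrite pv vA.
elim: p u uA up {pv} => //= w p IHp u uA /andP[uw wp].
by apply: IHp wp; apply: contra uA; apply: noin.
Qed.

(** The first step out of A ends at m. *)
Lemma walk_through_separator n u v : u \in A -> v \notin A -> walk n u v ->
  exists i j, [/\ n = (i + j)%N, walk i u m & walk j m v].
Proof.
move=> uA vA /walkP[p [<- up pv]].
elim: p u uA up pv => [u uA _ uv|w p IHp u uA /= /andP[uw wp] pv].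
  by case/negP: vA; rewrite -uv.
have w1 : walk 1 u w by apply/walkP; exists [:: w]; rewrite /= uw.
have [wA|wA] := boolP (w \in A).
  have [i [j [-> iwm jmv]]] := IHp w wA wp pv.
  by exists i.+1, j; split=> //; rewrite -add1n; apply: walk_cat w1 iwm.
have wm := outm uw uA wA.
exists 1%N, (size p); split=> //; first by rewrite -wm.
by apply/walkP; exists p; rewrite -wm.
Qed.

Lemma dist_through_separator u v : u \in A -> v \notin A ->
  dist K u v = (dist K u m + dist K m v)%E.
Proof.
move=> uA vA; apply/eqP; rewrite eq_le dist_triangle /=.
case: (distP u v) => [n /(walk_through_separator uA vA)|_]; last exact: leey.
by move=> [i [j [-> ium jmv]]]; rewrite natrD EFinD leeD // dist_le.
Qed.

End Separator.
End Distance.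

(** * Lengths of sequences and deletion of an entry *)

Section Sequences.
Variables (G : digraph) (K : realType).
Implicit Types (x y : G) (q u v : seq G) (L : K).

(** The recursive form of [len]: unlike the indexed sum, it computes on
concatenations. *)
Fixpoint path_len x q : \bar K :=
  if q is y :: q' then (dist K x y + path_len y q')%E else 0%E.

Definition seq_len q : \bar K := if q is x :: q' then path_len x q' else 0%E.

Definition simplex_seq L q :=
  sorted (fun x y => x != y) q && (seq_len q == L%:E).

Definition del_at (j : nat) q := take j q ++ drop j.+1 q.

Lemma path_len_ge0 x q : (0 <= path_len x q)%E.
Proof. by elim: q x => //= y q IHq x; rewrite adde_ge0 ?dist_ge0. Qed.

Lemma path_len_cat x q q' :
  path_len x (q ++ q') = (path_len x q + path_len (last x q) q')%E.
Proof. by elim: q x => [|y q IHq] x /=; rewrite ?add0e // IHq addeA. Qed.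

Lemma path_lenE x0 x q :
  path_len x q =
  (\sum_(0 <= i < size q) dist K (nth x0 (x :: q) i) (nth x0 q i))%E.
Proof.
elim: q x => [|y q IHq] x /=; first by rewrite big_nil.
by rewrite big_nat_recl //= IHq.
Qed.

Lemma is_simplexE k L (x : k.+1.-tuple G) : is_simplex L x = simplex_seq L x.
Proof.
rewrite /is_simplex /simplex_seq /len /entry; congr (_ && (_ == _)).
move: (thead x) => x0; case: (tval x) (size_tuple x) => [|a q] //= [qk].
by rewrite (path_lenE x0) big_add1 /= qk.
Qed.

Lemma del_at_catl j u v :
  (j < size u)%N -> del_at j (u ++ v) = del_at j u ++ v.
Proof.
move=> ju; rewrite /del_at take_cat drop_cat ju -catA; congr (_ ++ _).
case: ltnP => // uj; have -> : size u = j.+1 by apply/eqP; rewrite eqn_leq uj.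
by rewrite subnn drop0 drop_oversize.
Qed.

Lemma del_at_catr j u v : del_at (size u + j) (u ++ v) = u ++ del_at j v.
Proof.
rewrite /del_at take_cat ltnNge leq_addr -addnS drop_cat ltnNge leq_addr /=.
by rewrite !addKn catA.
Qed.

Lemma size_del_at j q : (j < size q)%N -> size (del_at j q) = (size q).-1.
Proof.
move=> jq; rewrite size_cat size_drop size_takel ?(ltnW jq) //.
by case: (size q) jq => // n; rewrite ltnS subSS => /subnKC.
Qed.

Lemma all_del_at (P : pred G) j q : all P q -> all P (del_at j q).
Proof.
move=> /allP Pq; apply/allP => x; rewrite mem_cat.
by case/orP => [/mem_take|/mem_drop]; apply: Pq.
Qed.

Lemma fin_addeP (a b : \bar K) (r : K) : (0 <= a)%E -> (0 <= b)%E ->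
  (a + b = r%:E)%E -> a <> +oo%E /\ exists r', b = r'%:E.
Proof. by case: a b => [a| |] [b| |] //= _ _ _; split=> //; exists b. Qed.

Lemma adde_sandwich_inj (a b c d : \bar K) (r : K) :
  (0 <= a)%E -> (0 <= b)%E -> (0 <= c)%E -> (0 <= d)%E ->
  (a + (b + d) = r%:E)%E -> (a + (c + d) = r%:E)%E -> b = c.
Proof.
case: a b c d => [a| |] [b| |] [c| |] [d| |] //= _ _ _ _ [<-] [].
by move=> /addrI /addIr ->.
Qed.

(** Deleting w replaces two summands of the length by d(last u, b); the other
summands can be cancelled because the total is finite. *)
Lemma seq_len_del_eq L a u w b v :
  seq_len (a :: u ++ w :: b :: v) = L%:E -> seq_len (a :: u ++ b :: v) = L%:E ->
  dist K (last a u) b = (dist K (last a u) w + dist K w b)%E.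
Proof.
rewrite /= !path_len_cat /= (addeA (dist _ _ w)) => xL delL.
by apply: adde_sandwich_inj delL xL;
  rewrite ?adde_ge0 ?path_len_ge0 ?dist_ge0.
Qed.

Lemma split_at_interior j q : (0 < j < (size q).-1)%N ->
  exists a u w b v, q = a :: u ++ w :: b :: v /\ j = (size u).+1.
Proof.
case: j q => [//|j] [//|a q] /= jq.
have szt : size (take j q) = j by rewrite size_takel // ltnW // ltnW.
have : (1 < size (drop j q))%N by rewrite size_drop ltn_subRL addn1.
case: (drop j q) (cat_take_drop j q) => [|w [|b v]] // qE _.
by exists a, (take j q), w, b, v; rewrite szt qE.
Qed.

Lemma entry_ends k (x : k.+1.-tuple G) a q :
  tval x = a :: q -> entry x 0 = a /\ entry x k = last a q.
Proof.
move=> xE; have := size_tuple x; rewrite /entry xE /=; move: (thead x) => x0.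
case=> <-; split=> //.
by rewrite -[size q]/(size (a :: q)).-1 nth_last.
Qed.

End Sequences.

(** * Chains as combinations of sequences *)

Section Chains.
Variables (R : comPzRingType) (G : digraph) (K : realType).
Implicit Types (k : nat) (L : K) (q u v : seq G).

(** This is 0 if q is not a k-simplex of length L, in particular if two adjacent
entries of q coincide or if q has another length. *)
Definition basis k L q : MC R G k L := [ffun y => (tval (val y) == q)%:R].

Lemma basisP k L q :
  (exists2 x : simplex G k L, tval (val x) = q & simplex_seq L q)
  \/ basis k L q = 0 /\ ~~ ((size q == k.+1) && simplex_seq L q).
Proof.
have [/andP[qk qL]|nq] := boolP ((size q == k.+1) && simplex_seq L q).
  have sx : is_simplex L (Tuple qk) by rewrite is_simplexE.
  by left; exists (Sub (Tuple qk) sx).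
right; split=> //; apply/ffunP => y; rewrite !ffunE.
case: eqP => // yq; case/negP: nq; rewrite -yq size_tuple eqxx /=.
by rewrite -is_simplexE; apply: (valP y).
Qed.

Lemma chain_basis k L (c : MC R G k L) :
  c = \sum_x c x *: basis k L (tval (val x)).
Proof.
apply/ffunP => y; rewrite sum_ffunE (bigD1 y) //= big1 => [|x xy].
  by rewrite !ffunE eqxx addr0; apply/esym/mulr1.
rewrite !ffunE; case: eqP => [/val_inj/val_inj yx|_]; last exact: mulr0.
by rewrite yx eqxx in xy.
Qed.

(** The additivity condition in [face] holds iff the deletion preserves the
length, which is already encoded in the vanishing of [basis]. *)
Lemma face_basis k L j (x : simplex G k L) : (0 < j < k)%N ->
  face R j x = basis k.-1 L (del_at j (tval (val x))).
Proof.
move=> jk; rewrite /face; case: eqP => // dne.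
case: (basisP k.-1 L (del_at j (tval (val x)))) => [[y _]|[-> //]].
case/andP => _ /eqP delL; case: dne.
have := valP x; rewrite is_simplexE => /andP[_ /eqP].
move: delL; rewrite /entry /=; move: (thead _) => x0.
case: (@split_at_interior _ j (tval (val x))) => [|a [u [w [b [v [-> ->]]]]]].
  by rewrite size_tuple.
rewrite -[(size u).+1]addn0 -/(size (a :: u)).
rewrite (del_at_catr 0 (a :: u) [:: w, b & v]) => delL xL.
have ltSn n : (n.+1 < n)%N = false by rewrite ltnNge leqW.
rewrite addn0 -cat_cons !nth_cat ltSn ltnn prednK // leqnn subnn subSnn.
by rewrite nth_last; apply: seq_len_del_eq xL delL.
Qed.

Definition linear_ext k k' L L' (f : seq G -> MC R G k' L') (c : MC R G k L) :
  MC R G k' L' := \sum_x c x *: f (tval (val x)).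

Lemma linear_ext_linear k k' L L' f : linear (@linear_ext k k' L L' f).
Proof.
move=> r c c'; rewrite /linear_ext scaler_sumr -big_split /=.
by apply: eq_bigr => x _; rewrite !ffunE scalerDl scalerA.
Qed.

HB.instance Definition _ k k' L L' f :=
  GRing.isLinear.Build R (MC R G k L) (MC R G k' L') _
    (@linear_ext k k' L L' f) (@linear_ext_linear k k' L L' f).

Lemma linear_ext_basis k k' L L' (f : seq G -> MC R G k' L')
    (x : simplex G k L) :
  linear_ext f (basis k L (tval (val x))) = f (tval (val x)).
Proof.
rewrite /linear_ext (bigD1 x) //= big1 => [|y yx].
  by rewrite !ffunE eqxx addr0 scale1r.
rewrite !ffunE; case: eqP => [/val_inj/val_inj xy|_]; last exact: scale0r.
by rewrite xy eqxx in yx.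
Qed.

Lemma diffE k L (c : MC R G k L) :
  diff c = linear_ext (fun q => \sum_(1 <= j < k)
             (-1) ^+ j *: basis k.-1 L (del_at j q)) c.
Proof.
rewrite /diff /linear_ext; apply: eq_bigr => x _; congr (_ *: _).
by apply: eq_big_nat => j jk; rewrite face_basis.
Qed.

Lemma diff_basis k L q : size q = k.+1 -> simplex_seq L q ->
  diff (basis k L q) =
  \sum_(1 <= j < k) (-1) ^+ j *: basis k.-1 L (del_at j q).
Proof.
move=> qk qL.
case: (basisP k L q) => [[x <- _]|[_]]; last by rewrite qk eqxx qL.
by rewrite diffE linear_ext_basis.
Qed.

Lemma diff_lincomb k L (I : finType) (r : I -> R) (f : I -> MC R G k L) :
  diff (\sum_i r i *: f i) = \sum_i r i *: diff (f i).
Proof. by rewrite linear_sum; apply: eq_bigr => i _; exact: linearZ. Qed.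

End Chains.

(** * The contracting homotopy *)

Lemma sum_nat_shift (V : nmodType) (F : nat -> V) p n N : N = (n + p)%N ->
  \sum_(p <= j < N) F j = \sum_(0 <= i < n) F (i + p)%N.
Proof. by move=> ->; rewrite -{1}[p]add0n big_addn addnK. Qed.

Section Homotopy.
Variables (R : comPzRingType) (G : digraph) (K : realType).
Variables (A : pred G) (m : G).
Hypothesis noin : forall u v : G, arc u v -> v \in A -> u \in A.
Hypothesis outm :
  forall u v : G, arc u v -> u \in A -> v \notin A -> v = m.
Hypothesis mA : m \notin A.
Implicit Types (x y : G) (k : nat) (L : K) (q u v : seq G).

(** With A the left side of the cut, these are the pairs (u, v) for which u ++ v
crosses the cut exactly once, between the last entry of u and the first one
of v. *)
Definition crossing u v :=
  [&& u != [::], all (mem A) u, v != [::] & all [predC A] v].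

(** A consecutive pair going back into A would be at infinite distance. *)
Lemma finite_path_notin x q (r : K) :
  path_len K x q = r%:E -> x \notin A -> all [predC A] q.
Proof.
elim: q x r => //= y q IHq x r.
case/(fin_addeP (dist_ge0 _ _ _) (path_len_ge0 _ _ _)) => xy [r' yq] xA.
have yA : y \notin A.
  by apply/negP => yA; apply: xy; exact: (dist_notin_in K noin xA yA).
by rewrite /= yA (IHq y r').
Qed.

Lemma finite_path_crossing x q (r : K) :
    path_len K x q = r%:E -> x \in A -> last x q \notin A ->
  exists u v, crossing u v /\ x :: q = u ++ v.
Proof.
elim: q x r => [|y q IHq] x r /=; first by move=> _ ->.
case/(fin_addeP (dist_ge0 _ _ _) (path_len_ge0 _ _ _)) => xy [r' yq] xA qA.
have [yA|yA] := boolP (y \in A).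
  have [u [v [/and4P[_ uA v0 vA] ->]]] := IHq y r' yq yA qA.
  by exists (x :: u), v; split=> //; apply/and4P; split=> //=; rewrite xA.
exists [:: x], (y :: q); split=> //.
by apply/and4P; split; rewrite /= ?xA ?yA ?(finite_path_notin yq).
Qed.

(** The insertion preserves the length because the distance from the last entry
of u to the first one of v splits at m. Adjacent entries remain distinct unless
v starts with m, as m is not in A; in u ++ v the two entries around the cut are
distinct because only one of them is in A. *)
Lemma simplex_seq_insert L u v : crossing u v ->
  simplex_seq L (u ++ m :: v) = (head m v != m) && simplex_seq L (u ++ v).
Proof.
case: u v => [|x u] [|y v] //; first by rewrite /crossing andbF.
case/and4P => _ uA _ /= /andP[yA _].
have lA : last x u \in A by apply: (allP uA); apply: mem_last.
have lm : last x u != m by apply: contraNneq mA => <-.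
have ly : last x u != y by apply: contraNneq yA => <-.
rewrite /simplex_seq /= !path_len_cat !cat_path /= lm ly (eq_sym m).
rewrite (dist_through_separator K outm lA yA) !addeA.
by case: (y != m); rewrite ?andbF.
Qed.

(** In terms of u and v this is [cone_crossing]; the position of the first entry
outside A makes it a total function of the sequence. The case where v starts
with m needs no separate clause: [basis] vanishes on a repeated entry. *)
Definition cone k L q : MC R G k.+1 L :=
  let p := find [predC A] q in
  (-1) ^+ p *: basis R k.+1 L (take p q ++ m :: drop p q).

Definition homotopy k L : MC R G k L -> MC R G k.+1 L :=
  linear_ext (@cone k L).

HB.instance Definition _ k L :=
  GRing.Linear.copy (@homotopy k L) (linear_ext (@cone k L)).

Lemma cone_crossing k L u v : crossing u v ->
  cone k L (u ++ v) = (-1) ^+ size u *: basis R k.+1 L (u ++ m :: v).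
Proof.
case: v => [|y v]; first by rewrite /crossing !andbF.
case/and4P => _ uA _ /= /andP[yA _].
have p : find [predC A] (u ++ y :: v) = size u.
  rewrite find_cat ifN /= ?yA ?addn0 //.
  by rewrite has_predC negbK.
by rewrite /cone p take_size_cat // drop_size_cat.
Qed.

(** The sequence u ++ v may fail to be a simplex here, as happens for faces;
then so does u ++ m :: v, and both sides vanish. *)
Lemma homotopy_basis k L u v : crossing u v ->
  homotopy (basis R k L (u ++ v)) =
  (-1) ^+ size u *: basis R k.+1 L (u ++ m :: v).
Proof.
move=> cuv; rewrite -cone_crossing //.
case: (basisP R k L (u ++ v)) => [[x <- _]|[-> nx]].
  exact: linear_ext_basis.
rewrite raddf0 cone_crossing //.
case: (basisP R k.+1 L (u ++ m :: v)) => [[x xE]|[-> _]]; last first.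
  by rewrite scaler0.
rewrite simplex_seq_insert // => /andP[_ uvL]; case/negP: nx; rewrite uvL andbT.
by have := size_tuple (val x); rewrite xE !size_cat /= addnS => -[->].
Qed.

Lemma basis_repeat k L u v : basis R k L (u ++ m :: m :: v) = 0.
Proof.
case: (basisP R k L (u ++ m :: m :: v)) => [[_ _]|[] //].
by case/andP; rewrite sorted_cat_cons /= eqxx andbF.
Qed.

(** Deletions in u lower the position of the cut by one, hence the sign; for a
deletion in v at offset i the signs (-1) ^ (|u| + i) and (-1) ^ |u| combine to
(-1) ^ i. Both parts stay nonempty because only interior entries are deleted. *)
Lemma homotopy_boundary k L u v : crossing u v ->
    (size u + size v = k.+2)%N ->
  \sum_(1 <= j < k.+1) (-1) ^+ j *: homotopy (basis R k L (del_at j (u ++ v)))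
  = - ((-1) ^+ size u *: \sum_(1 <= j < size u)
         (-1) ^+ j *: basis R k.+1 L (del_at j u ++ m :: v))
    + \sum_(0 <= i < (size v).-1) (-1) ^+ i *:
         basis R k.+1 L (u ++ m :: del_at i v).
Proof.
move=> /and4P[u0 uA v0 vA] kE.
have su : (0 < size u)%N by rewrite lt0n size_eq0.
have sv : (0 < size v)%N by rewrite lt0n size_eq0.
have kE' : (k.+1 = (size v).-1 + size u)%N.
  by apply/eqP; rewrite -eqSS -kE -addSn prednK // addnC.
rewrite (big_cat_nat su) /=; last by rewrite kE' leq_addl.
congr (_ + _).
  rewrite scaler_sumr -sumrN; apply: eq_big_nat => j /andP[j0 ju].
  have sd := size_del_at ju.
  rewrite del_at_catl // homotopy_basis.
    rewrite sd !scalerA -scaleNr; congr (_ *: _).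
    by rewrite -{2}(prednK su) exprS mulN1r mulNr opprK mulrC.
  apply/and4P; split=> //; last exact: all_del_at.
  by rewrite -size_eq0 sd -lt0n -ltnS prednK // (leq_ltn_trans j0).
rewrite (sum_nat_shift _ kE'); apply: eq_big_nat => i /andP[_ iv].
have iv' : (i < size v)%N by apply: leq_trans iv _; apply: leq_pred.
have sd := size_del_at iv'.
rewrite addnC del_at_catr homotopy_basis.
  by rewrite scalerA addnC exprD -mulrA -expr2 sqrr_sign mulr1.
apply/and4P; split=> //; last exact: all_del_at.
by rewrite -size_eq0 sd -lt0n (leq_ltn_trans _ iv).
Qed.

(** The hypothesis on the last entry serves to exclude v = [:: m], the one
case in which an m at the head of v is an end of the simplex and cannot be
deleted. *)
Lemma homotopy_formula k L u v :
    crossing u v -> size (u ++ v) = k.+2 -> simplex_seq L (u ++ v) ->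
    last m v != m ->
  diff (cone k.+1 L (u ++ v)) +
  homotopy (diff (basis R k.+1 L (u ++ v))) = basis R k.+1 L (u ++ v).
Proof.
move=> cuv kE xL vm; rewrite diff_basis // linear_sum /=.
under eq_bigr do rewrite linearZ /=.
rewrite size_cat in kE.
rewrite homotopy_boundary // cone_crossing //.
have [/eqP hm|hm] := boolP (head m v == m).
  case: v hm cuv xL kE vm => [|y v] /=; first by rewrite /crossing !andbF.
  move=> -> _ _ kE vm; rewrite basis_repeat scaler0 raddf0 add0r.
  rewrite big1_seq ?scaler0 ?oppr0 ?add0r => [|j _]; last first.
    by rewrite basis_repeat scaler0.
  (* All terms repeat m, except the one that deletes the head m of v. *)
  case: v vm kE => [|z v]; first by rewrite /= eqxx.
  move=> _ _; rewrite big_nat_recl //= scale1r big1_seq ?addr0 // => i _.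
  by rewrite basis_repeat scaler0.
have iL : simplex_seq L (u ++ m :: v) by rewrite simplex_seq_insert // hm.
rewrite linearZ /= diff_basis //; last by rewrite size_cat /= addnS kE.
case/and4P: cuv => u0 _ v0 _.
have su : (0 < size u)%N by rewrite lt0n size_eq0.
have sv : (0 < size v)%N by rewrite lt0n size_eq0.
have kE' : (k.+2 = (size v).-1.+1 + size u)%N by rewrite prednK // addnC kE.
rewrite (big_cat_nat su) /=; last by rewrite kE' leq_addl.
(* The term at position size u, which deletes the inserted m, is u ++ v. *)
rewrite (sum_nat_shift _ kE') big_nat_recl //.
have dm : del_at (size u) (u ++ m :: v) = u ++ v.
  by rewrite -{1}[size u]addn0 del_at_catr /del_at /= drop0.
rewrite add0n dm !scalerDr scalerA -expr2 sqrr_sign scale1r.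
have -> : \sum_(1 <= j < size u)
      (-1) ^+ j *: basis R k.+1 L (del_at j (u ++ m :: v)) =
    \sum_(1 <= j < size u)
      (-1) ^+ j *: basis R k.+1 L (del_at j u ++ m :: v).
  by apply: eq_big_nat => j /andP[_ ju]; rewrite del_at_catl.
set X := _ *: _; set Y := _ *: _; set Z := \sum_(0 <= i < _) _.
have -> : Y = - Z.
  rewrite /Y /Z scaler_sumr -sumrN; apply: eq_big_nat => i _.
  rewrite addnC del_at_catr /del_at /= scalerA -scaleNr; congr (_ *: _).
  by rewrite exprD mulrA -expr2 sqrr_sign mul1r exprS mulN1r.
by rewrite addrACA subrr add0r subrK.
Qed.

Lemma MCab_crossing k L a b (c : MC R G k L) (x : simplex G k L) :
    a \in A -> b \notin A -> c \in @MCab R G K a b k L -> c x != 0 ->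
  exists u v, [/\ crossing u v, tval (val x) = u ++ v, head m u = a &
                  last m v = b].
Proof.
move=> aA bA /forallP/(_ x)/implyP cx /cx /andP[/eqP xa /eqP xb].
have := valP x; rewrite is_simplexE => /andP[_ /eqP].
case xE: (tval (val x)) (size_tuple (val x)) => [//|y q] _ /= qL.
have [ya yb] := entry_ends xE; rewrite xa in ya; rewrite xb in yb.
rewrite -ya in xE qL yb *; rewrite yb in bA *.
have [u [v [cuv uv]]] := finite_path_crossing qL aA bA.
exists u, v; rewrite uv; split=> //; case/and4P: cuv => u0 _ v0 _.
  by case: u u0 uv => //= y' u _ [->].
have := congr1 (last m) uv; rewrite last_cat /= => ->.
by case: v v0 {uv}.
Qed.

Lemma homotopy_MCab k L a b (c : MC R G k L) :
  a \in A -> b \notin A -> c \in @MCab R G K a b k L ->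
  homotopy c \in @MCab R G K a b k.+1 L.
Proof.
move=> aA bA cab.
have [h0 hD] := MCab_submod R (K := K) a b k.+1 L.
rewrite /homotopy /linear_ext; elim/big_ind: _ => [||x _]; first exact: h0.
  by move=> f g fM gM; rewrite -[f]scale1r; apply: hD.
have [->|cx] := eqVneq (c x) 0; first by rewrite scale0r.
have [u [v [cuv -> ua vb]]] := MCab_crossing aA bA cab cx.
rewrite cone_crossing // scalerA.
suff bM : basis R k.+1 L (u ++ m :: v) \in @MCab R G K a b k.+1 L.
  by have := hD (c x * (-1) ^+ size u) _ _ bM h0; rewrite addr0.
apply/forallP => y; apply/implyP; rewrite ffunE.
case: (tval (val y) =P _) => [yE _|_]; last by rewrite eqxx.
case/and4P: cuv ua vb yE => u0 _ v0 _.
case: u u0 => //= a' u _ -> vb yE; have [-> ->] := entry_ends yE.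
by rewrite last_cat /= vb !eqxx.
Qed.

(** The homotopy [homotopy_formula] needs degree at least 1; in degree 0
every chain from a to b is 0, as a simplex from A to its complement has at least
two entries. *)
Theorem MH_separator_eq0 a b k L (h : MH R a b k L) :
  a \in A -> b \notin A -> b != m -> h = 0.
Proof.
move=> aA bA bm; elim/quotW: h => z.
suff zB : z \in @boundaries R G K a b k L.
  rewrite -(raddf0 \pi_(MH R a b k L)%qT).
  by apply/eqP; rewrite -Quotient.idealrBE subr0.
have /andP[zab /eqP dz] := valP z.
apply/asboolP; exists (homotopy (val z)); first exact: homotopy_MCab.
case: k L z zab dz => [|k] L z zab dz.
  suff -> : val z = 0 by rewrite !raddf0.
  apply/ffunP => x; rewrite ffunE; apply/eqP/negPn/negP => zx.
  have [u [v [/and4P[u0 _ v0 _] uv _ _]]] := MCab_crossing aA bA zab zx.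
  have := size_tuple (val x); rewrite uv size_cat.
  by case: u v u0 v0 {uv} => [|? u] [|? v] //=; rewrite addnS.
have hdz : homotopy (diff (val z)) =
    \sum_x val z x *: homotopy (diff (basis R k.+1 L (tval (val x)))).
  rewrite {1}[val z]chain_basis diff_lincomb linear_sum.
  by apply: eq_bigr => x _; rewrite linearZ.
have hdz0 : homotopy (diff (val z)) = 0 by rewrite dz raddf0.
rewrite [RHS]chain_basis -[LHS]addr0 -[X in _ + X]hdz0 hdz.
rewrite {1}/homotopy {1}/linear_ext diff_lincomb -big_split.
apply: eq_bigr => x _ /=; rewrite -scalerDr.
have [->|zx] := eqVneq (val z x) 0; first by rewrite !scale0r.
congr (_ *: _).
have [u [v [cuv uv _ vb]]] := MCab_crossing aA bA zab zx.
rewrite uv; apply: homotopy_formula => //; last by rewrite vb.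
  by rewrite -uv size_tuple.
by rewrite -uv -is_simplexE; apply: (valP x).
Qed.

End Homotopy.

(** * The glued digraph *)

Section Gluing.
Variables (D D' : digraph) (t : D) (s' : D').

Lemma glue_inl_inj (u v : D) : glue_inl t s' u = glue_inl t s' v -> u = v.
Proof.
move/eqmodP; rewrite /= /glue_rel.
by case/or3P => [/eqP[]|/andP[_ /eqP]|/andP[/eqP]].
Qed.

Lemma glue_inr_inl (u : D) (v : D') :
  glue_inr t s' v = glue_inl t s' u -> v = s' /\ u = t.
Proof.
move/eqmodP; rewrite /= /glue_rel.
by case/or3P => [/eqP|/andP[/eqP]|/andP[/eqP[->] /eqP[->]]].
Qed.

Definition left_part : pred (glue t s') :=
  [pred x | [exists u : D, (u != t) && (glue_inl t s' u == x)]].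

Lemma left_part_inl (u : D) : (glue_inl t s' u \in left_part) = (u != t).
Proof.
apply/existsP/idP => [[v /andP[vt /eqP/glue_inl_inj <-]]//|ut].
by exists u; rewrite ut /=.
Qed.

Lemma left_part_inr (v : D') : glue_inr t s' v \notin left_part.
Proof.
apply/existsP => -[u /andP[ut /eqP/esym/glue_inr_inl[_ utE]]].
by rewrite utE eqxx in ut.
Qed.

Lemma glue_arcP (x y : glue t s') : arc x y ->
  (exists u v, [/\ arc u v, x = glue_inl t s' u & y = glue_inl t s' v]) \/
  (exists u v, [/\ arc u v, x = glue_inr t s' u & y = glue_inr t s' v]).
Proof.
case/existsP => -[u|u] /existsP[[v|v]] /and3P[uv /eqP <- /eqP <-] //.
  by left; exists u, v.
by right; exists u, v.
Qed.

End Gluing.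

Lemma target_no_arc (D : digraph) (s t : D) :
  st_dag s t -> forall v, ~~ arc t v.
Proof.
case=> _ _ /(_ t)[_ /(_ erefl)/eqP]; rewrite cards_eq0 => /eqP t0 v.
by have := in_set0 v; rewrite -t0 inE => ->.
Qed.

Theorem theorem2 (R : comPzRingType) (K : realType)
    (D D' : digraph) (s t : D) (s' t' : D') :
  st_dag s t -> t <> s -> st_dag s' t' -> t' <> s' ->
  forall (k : nat) (L : K)
    (h : MH R (glue_inl t s' s) (glue_inr t s' t') k L), h = 0%R.
Proof.
move=> stD ts _ ts' k L h.
apply: (@MH_separator_eq0 R _ K (@left_part D D' t s') (glue_inl t s' t)).
- move=> x y /glue_arcP[] [u [v [uv -> ->]]]; last first.
    by rewrite (negPf (left_part_inr _ _ _)).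
  by move=> _; rewrite left_part_inl; apply/eqP => ut;
    move: uv; rewrite ut (negPf (target_no_arc stD v)).
- move=> x y /glue_arcP[] [u [v [uv -> ->]]].
    by rewrite !left_part_inl negbK => _ /eqP ->.
  by rewrite (negPf (left_part_inr _ _ _)).
- by rewrite left_part_inl eqxx.
- by rewrite left_part_inl; apply/eqP => /esym.
- exact: left_part_inr.
by apply/eqP => /glue_inr_inl[].
Qed.
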